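(* Let $a\ge1$ and $0\le b<a$ be integers with $(a,b)\neq(1,0)$, and run the golden sieve on $W_0=a\mathbb{N}+b$. Then for every $n\ge1$ the first $n$ elements of the working sequence $W_{n-1}$ are exactly the first $n$ survivors $s_1,\ldots,s_n$. In particular, $$h_n=s_n\quad\text{and}\quad \eta_n=\sigma_n\qquad(n\ge1).$$
   Context: $\mathbb{N}=\{1,2,3,\ldots\}$ and $a\mathbb{N}+b=\{an+b:n\ge1\}$, viewed as an increasing sequence. For a strictly increasing sequence $X$ of positive integers, $X(k)$ denotes its $k$-th term. Golden sieve: let $W_0=(w_1<w_2<\cdots)$ be an infinite strictly increasing sequence of positive integers. For $n\ge1$ define inductively $h_n:=W_{n-1}(n)$ (the pointer), $d_n:=W_{n-1}(h_n)$ (the deletion), and let $W_n$ be the increasing sequence obtained from $W_{n-1}$ by removing the value $d_n$. The survivor sequence $(s_n)_{n\ge1}$ is the increasing enumeration of $W_0\setminus\{d_1,d_2,\ldots\}$. Normalization for $W_0=a\mathbb{N}+b$: $\sigma_n:=(s_n-b)/a$ and $\delta_n:=(d_n-b)/a$. The working index sequence $I_{n-1}$ is the increasing sequence obtained from $W_{n-1}$ by applying $an+b\mapsto n$ entrywise (equivalently, $\mathbb{N}$ with $\delta_1,\ldots,\delta_{n-1}$ removed), and $\eta_n:=I_{n-1}(n)$, so that $h_n=a\eta_n+b$. *)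

(* Defs.v *)
From mathcomp Require Import all_boot.
From mathcomp Require Import boolp classical_sets cardinality.

Set Implicit Arguments.
Unset Strict Implicit.
Unset Printing Implicit Defensive.

Local Open Scope classical_set_scope.

(* A sequence of positive integers is a function [X : nat -> nat] whose k-th
   term is [X k] for [k >= 1]; the value [X 0] is never used. *)

Definition terms (X : nat -> nat) : set nat := X @` [set k | 0 < k].

Definition is_enum (A : set nat) (X : nat -> nat) : Prop :=
  (forall j k, 0 < j -> j < k -> X j < X k) /\ terms X = A.

(* The increasing enumeration of [A]. It is determined at indices [k >= 1]
   ([is_enum_unique]) and exists when [A] is infinite ([incr_enumP]). The
   default [fun=> 0] is returned only when [A] has no such enumeration. *)
Definition incr_enum (A : set nat) : nat -> nat :=
  xget (fun=> 0) [set X | is_enum A X].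

Definition remove_value (X : nat -> nat) (d : nat) : nat -> nat :=
  incr_enum (terms X `\ d).

Section GoldenSieve.
Variable W0 : nat -> nat.

(* [working n] is W_n; the pointer and the deletion of step n.+1, namely
   W_n(n.+1) and W_n(W_n(n.+1)), are written out here and named below. *)
Fixpoint working (n : nat) : nat -> nat :=
  if n is m.+1 then
    remove_value (working m) (working m (working m m.+1))
  else W0.

(* Meaningful for [n >= 1], as are all the sequences below. *)
Definition pointer (n : nat) : nat := working n.-1 n.

Definition deletion (n : nat) : nat := working n.-1 (pointer n).

Definition survivor : nat -> nat := incr_enum (terms W0 `\` terms deletion).

End GoldenSieve.

Definition arith_seq (a b : nat) : nat -> nat := fun n => a * n + b.

(* The map a n + b |-> n; the truncated subtraction and the division are exact
   on the values taken by [arith_seq a b] ([normalizeK]). *)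
Definition normalize (a b x : nat) : nat := (x - b) %/ a.

Definition working_index (a b n : nat) : nat -> nat :=
  fun k => normalize a b (working (arith_seq a b) n k).

Definition eta (a b n : nat) : nat := working_index a b n.-1 n.

Definition sigma (a b n : nat) : nat :=
  normalize a b (survivor (arith_seq a b) n).

Lemma normalizeK (a b : nat) : 0 < a -> cancel (arith_seq a b) (normalize a b).
Proof. by move=> a0 n; rewrite /normalize /arith_seq addnK mulKn. Qed.

Lemma working_step (W0 : nat -> nat) (n : nat) : 0 < n ->
  working W0 n = remove_value (working W0 n.-1) (deletion W0 n).
Proof. by case: n. Qed.

Lemma is_enum_unique (A : set nat) (X Y : nat -> nat) :
  is_enum A X -> is_enum A Y -> forall k, 0 < k -> X k = Y k.
Proof.
have le (U V : nat -> nat) k : is_enum A U -> is_enum A V -> 0 < k ->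
    (forall j, 0 < j -> j < k -> U j = V j) -> U k <= V k.
  move=> [Umono UA] [Vmono VA] k0 IH.
  have : terms U (V k) by rewrite UA -VA; exists k.
  case=> i /= i0 Ui; rewrite -Ui.
  case: (ltngtP i k) => [ik|ki|->//]; last exact/ltnW/Umono.
  by have := Vmono _ _ i0 ik; rewrite -Ui IH// ltnn.
move=> HX HY; elim/ltn_ind=> k IH k0; apply/eqP; rewrite eqn_leq.
by rewrite (le X Y)// ?(le Y X)// => j j0 jk; rewrite IH.
Qed.

Lemma incr_enumP (A : set nat) :
  infinite_set A -> ~ A 0 -> is_enum A (incr_enum A).
Proof.
move=> Ainf A0; apply: (@xgetPex _ _ [set X | is_enum A X]).
have next m : exists x, `[< A x >] && (m < x).
  apply: contrapT => N; apply: Ainf; apply: (@sub_finite_set _ _ `I_m.+1).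
    move=> x Ax /=; rewrite ltnS leqNgt; apply/negP => mx; apply: N.
    by exists x; rewrite mx andbT; apply/asboolP.
  exact: finite_II.
pose f m := ex_minn (next m).
have fA m : A (f m) by rewrite /f; case: ex_minnP => x /andP[/asboolP].
have fgt m : m < f m by rewrite /f; case: ex_minnP => x /andP[].
have fle m x : A x -> m < x -> f m <= x.
  move=> Ax mx; rewrite /f; case: ex_minnP => y _; apply.
  by rewrite mx andbT; apply/asboolP.
pose X k := iter k f 0.
have Xmono : {homo X : j k / j < k} by apply: homo_ltn ltn_trans _ => k; apply: fgt.
exists X; split=> [j k _|]; first exact: Xmono.
apply/seteqP; split=> [_ [[|k] //= _ <-]|x Ax]; first exact: fA.
have x0 : 0 < x by case: x Ax => // /A0.
apply: contrapT => Nx.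
have Xlt k : X k < x.
  elim: k => // k IH; rewrite ltn_neqAle fle// andbT; apply/eqP => Xx.
  by apply: Nx; exists k.+1.
have Xge k : k <= X k by elim: k => // k IH; apply: leq_ltn_trans (fgt _).
by have := leq_ltn_trans (Xge x) (Xlt x); rewrite ltnn.
Qed.

(* Main.v *)
Require Import Defs.
From mathcomp Require Import all_boot.
From mathcomp Require Import boolp classical_sets.

(** Since [(a, b) <> (1, 0)] forces [a >= 2], every working sequence satisfies
    [W_m(k) > k]. Hence step [n] deletes the entry at position [h_n > n], so
    positions [1, ..., n] are frozen from [W_{n-1}] on. The diagonal sequence
    [k |-> W_{k-1}(k)] therefore consists of values that are never deleted, and
    it contains every such value [x], because [x] sits at a position [<= x] in
    [W_x]. *)

Set Implicit Arguments.
Unset Strict Implicit.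
Unset Printing Implicit Defensive.

Local Open Scope classical_set_scope.

Definition increasing_from1 (X : nat -> nat) : Prop :=
  forall j k, 0 < j -> j < k -> X j < X k.

(** [X] itself witnesses that the choice in [incr_enum] does not fall back on its default;
    uniqueness of enumerations does the rest. *)
Lemma incr_enumE (A : set nat) (X : nat -> nat) :
  is_enum A X -> forall k, 0 < k -> incr_enum A k = X k.
Proof.
move=> AX; apply: (is_enum_unique _ AX).
by apply: (@xgetPex _ _ [set X | is_enum A X]); exists X.
Qed.

Lemma increasing_from1_inj (X : nat -> nat) : increasing_from1 X ->
  forall j k, 0 < j -> 0 < k -> X j = X k -> j = k.
Proof.
move=> Xincr j k j0 k0 Xjk; case: (ltngtP j k) => // [jk|kj].
- by have := Xincr _ _ j0 jk; rewrite Xjk ltnn.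
- by have := Xincr _ _ k0 kj; rewrite Xjk ltnn.
Qed.

(** Turns removal of a value into a formula in positions: entries before [i] stay, later ones shift
    down by one. *)
Lemma is_enum_remove (X : nat -> nat) (i : nat) :
  increasing_from1 X -> 0 < i ->
  is_enum (terms X `\ X i) (fun k => if k < i then X k else X k.+1).
Proof.
move=> Xincr i0; split=> [j k j0 jk|].
  case: (ltnP j i) => ji; case: (ltnP k i) => ki; try exact: Xincr.
  - by apply: Xincr => //; apply: ltnW.
  - by have := leq_ltn_trans (leq_trans ji (ltnW jk)) ki; rewrite ltnn.
apply/seteqP; split=> [_ [k /= k0 <-]|_ [[j /= j0 <-] Xji]].
  case: (ltnP k i) => ki; split.
  - by exists k.
  - by move=> /(increasing_from1_inj Xincr k0 i0) kE; rewrite kE ltnn in ki.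
  - by exists k.+1.
  - move=> /(increasing_from1_inj Xincr (ltn0Sn k) i0) kE.
    by rewrite -kE ltnn in ki.
case: (ltngtP j i) => [ji|ij|jE]; last by case: Xji; rewrite jE.
- by exists j => //; rewrite ji.
(* A term beyond position [i] moves one place to the left, so the predecessor of its index is the
   witness. *)
- case: j j0 ij {Xji} => // j _ ij; exists j => /=.
    exact: leq_trans i0 ij.
  by rewrite ltnNge -ltnS ij.
Qed.

Lemma remove_valueE (X : nat -> nat) (i k : nat) :
  increasing_from1 X -> 0 < i -> 0 < k ->
  remove_value X (X i) k = if k < i then X k else X k.+1.
Proof.
by move=> Xincr i0 k0; rewrite /remove_value (incr_enumE (is_enum_remove Xincr i0)).
Qed.

Lemma increasing_from1_remove (X : nat -> nat) (i : nat) :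
  increasing_from1 X -> 0 < i -> increasing_from1 (remove_value X (X i)).
Proof.
move=> Xincr i0 j k j0 jk.
rewrite !remove_valueE//; last exact: ltn_trans jk.
exact: (is_enum_remove Xincr i0).1.
Qed.

Lemma terms_remove (X : nat -> nat) (i : nat) :
  increasing_from1 X -> 0 < i ->
  terms (remove_value X (X i)) = terms X `\ X i.
Proof.
move=> Xincr i0; case: (is_enum_remove Xincr i0) => _ <-.
by apply/seteqP; split=> _ [k /= k0 <-]; exists k; rewrite //= remove_valueE.
Qed.

Lemma increasing_from1_arith (a b : nat) : 0 < a ->
  increasing_from1 (arith_seq a b).
Proof. by move=> a0 j k _ jk; rewrite /arith_seq ltn_add2r ltn_pmul2l. Qed.

(** Supplies the growth hypothesis [W0gt] of the sieve argument below. *)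
Lemma arith_seq_gt (a b k : nat) : 1 < a -> 0 < k -> k < arith_seq a b k.
Proof. by move=> a1 k0; apply/ltn_addr/ltn_Pmull. Qed.

Section FastSieve.
Variable W0 : nat -> nat.
Hypothesis W0incr : increasing_from1 W0.
Hypothesis W0gt : forall k, 0 < k -> k < W0 k.

(** Both properties go through one induction: the positional formula for removal needs monotonicity
    and a positive pointer, and the growth bound gives the latter. Growth persists because each
    entry is kept or replaced by its right neighbour. *)
Lemma working_increasing_gt (n : nat) :
  increasing_from1 (working W0 n) /\ forall k, 0 < k -> k < working W0 n k.
Proof.
elim: n => [|n [Wincr Wgt]] //=.
have h0 : 0 < working W0 n n.+1 by apply: ltn_trans (Wgt _ _).
split=> [|k k0]; first exact: increasing_from1_remove.
rewrite remove_valueE//; case: ifP => _; first exact: Wgt.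
by apply: ltnW; apply: Wgt.
Qed.

Lemma working_increasing (n : nat) : increasing_from1 (working W0 n).
Proof. by case: (working_increasing_gt n). Qed.

Lemma working_gt (n k : nat) : 0 < k -> k < working W0 n k.
Proof. by case: (working_increasing_gt n) => _; apply. Qed.

Lemma pointer_gt0 (n : nat) : 0 < n -> 0 < pointer W0 n.
Proof. by move=> n0; apply: ltn_trans (working_gt _ n0). Qed.

Lemma terms_workingS (n : nat) :
  terms (working W0 n.+1) = terms (working W0 n) `\ deletion W0 n.+1.
Proof. exact: terms_remove (working_increasing n) (pointer_gt0 (ltn0Sn n)). Qed.

Lemma terms_working_sub (m n : nat) : m <= n ->
  terms (working W0 n) `<=` terms (working W0 m).
Proof.
move=> /subnKC <-; elim: (n - m) => [|p IH]; first by rewrite addn0.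
by rewrite addnS terms_workingS => x [/IH].
Qed.

(** Step [n + p + 1] deletes at a position larger than [n + p + 1 >= k], so the entry at [k] lies
    before the gap. *)
Lemma working_frozen (n m k : nat) : 0 < k -> k <= n.+1 -> n <= m ->
  working W0 m k = working W0 n k.
Proof.
move=> k0 kn /subnKC <-; elim: (m - n) => [|p IH]; first by rewrite addn0.
rewrite addnS /= remove_valueE//; last 2 first.
- exact: working_increasing.
- exact: (pointer_gt0 (ltn0Sn (n + p))).
rewrite ifT//; apply: leq_ltn_trans (working_gt _ (ltn0Sn _)).
by apply: (leq_trans kn); rewrite ltnS leq_addr.
Qed.

Lemma survivors_in_working (x : nat) :
  (terms W0 `\` terms (deletion W0)) x -> forall n, terms (working W0 n) x.
Proof.
move=> [W0x Dx]; elim=> [|n IH] //; rewrite terms_workingS; split=> //.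
by move=> /= xd; apply: Dx; exists n.+1.
Qed.

Lemma is_enum_pointer :
  is_enum (terms W0 `\` terms (deletion W0)) (pointer W0).
Proof.
have pointerE j m : 0 < j -> j.-1 <= m -> pointer W0 j = working W0 m j.
  by move=> j0 jm; rewrite (@working_frozen j.-1)// prednK.
split=> [j k j0 jk|].
  rewrite (pointerE j k.-1)//; first exact: working_increasing.
  by rewrite -!subn1 leq_sub2r// ltnW.
apply/seteqP; split=> [_ [k /= k0 <-]|x Ax].
  (* The value is read in $W_{m+k}$, late enough for position [k] to be frozen, and $W_{m+k}$ has
     its terms among those of $W_m$. *)
  have inW m : terms (working W0 m) (pointer W0 k).
    apply: (terms_working_sub (leq_addr k m)).
    exists k => //; rewrite (pointerE k (m + k))//.
    exact: leq_trans (leq_pred k) (leq_addl m k).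
  split; first exact: inW 0.
  move=> [[|n] //= _ dk].
  by have := inW n.+1; rewrite terms_workingS => -[_]; apply.
(* The value [x] also serves as the time: its position [k] in $W_x$ satisfies $k < W_x(k) = x$, so
   that position is already frozen. *)
have [k /= k0 Wk] := survivors_in_working Ax x.
exists k => //; rewrite (pointerE k x)//.
by apply: leq_trans (leq_pred k) _; rewrite -Wk ltnW// working_gt.
Qed.

Lemma pointer_survivor (n : nat) : 0 < n -> pointer W0 n = survivor W0 n.
Proof. by move=> n0; rewrite /survivor (incr_enumE is_enum_pointer). Qed.

Lemma working_survivor (n k : nat) : 1 <= k <= n ->
  working W0 n.-1 k = survivor W0 k.
Proof.
move=> /andP[k0 kn]; rewrite -pointer_survivor// (@working_frozen k.-1)//.
  by rewrite prednK.
by rewrite -!subn1 leq_sub2r.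
Qed.

End FastSieve.

Theorem proposition3p3 (a b : nat) (ha : 1 <= a) (hb : b < a)
    (hab : (a, b) <> (1, 0)) (n : nat) (hn : 1 <= n) :
  (forall k : nat, 1 <= k <= n ->
     working (arith_seq a b) n.-1 k = survivor (arith_seq a b) k) /\
  pointer (arith_seq a b) n = survivor (arith_seq a b) n /\
  eta a b n = sigma a b n.
Proof.
(* If [a] were 1, then [b < a] would force [b = 0], the excluded pair. *)
have a1 : 1 < a.
  rewrite ltn_neqAle ha andbT; apply/eqP => aE; apply: hab.
  by move: hb; rewrite -aE ltnS leqn0 => /eqP ->.
have Wincr := increasing_from1_arith b ha.
have Wgt k : 0 < k -> k < arith_seq a b k by apply: arith_seq_gt.
have hs := pointer_survivor Wincr Wgt hn.
split=> [k|]; first exact: working_survivor.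
by split=> //; rewrite /eta /working_index /sigma -hs.
Qed.
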